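(* Let $k\ge2$ be even, $0<\epsilon\le 1/2$, and let $\mathcal P=\{\mathbf p_z: z\in\{-1,+1\}^{k/2}\}$ be the family of distributions on $[k]$ given by $\mathbf p_z(2i-1)=\frac{1+2\epsilon z_i}{k}$, $\mathbf p_z(2i)=\frac{1-2\epsilon z_i}{k}$ for $i\in[k/2]$. Then for every channel $W$ from $[k]$ to a finite set $\mathcal Y$, \[\chi^2(W\mid\mathcal P)=\frac{4\epsilon^2}{k}\,\|H(W)\|_*.\]
   Context: A channel $W$ from $[k]$ to $\mathcal Y$ is a stochastic matrix with entries $W(y\mid x)$; for $\mathbf p$ a distribution on $[k]$, $\mathbf p^W(y)=\sum_x\mathbf p(x)W(y\mid x)$. $\mathbf u$ denotes the uniform distribution on $[k]$. The chi-square distance is $\chi^2(\mathbf p,\mathbf q)=\sum_y(\mathbf p(y)-\mathbf q(y))^2/\mathbf q(y)$. The induced chi-square fluctuation is $\chi^2(W\mid\mathcal P)=\mathbb E_Z[\chi^2(\mathbf p_Z^W,\mathbf u^W)]$, with $Z$ uniform on $\{-1,+1\}^{k/2}$. $H(W)$ is the $(k/2)\times(k/2)$ positive semidefinite matrix with entries $H(W)_{i_1,i_2}=\sum_{y\in\mathcal Y}\frac{(W(y\mid 2i_1-1)-W(y\mid 2i_1))(W(y\mid 2i_2-1)-W(y\mid 2i_2))}{\sum_{x\in[k]}W(y\mid x)}$ (terms with zero denominator, whose numerators vanish, are omitted). $\|\cdot\|_*$ is the nuclear (trace) norm, the sum of singular values. *)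

(* Defs.v *)
From mathcomp Require Import all_boot all_order all_algebra.
From mathcomp Require Import reals.
From mathcomp Require Import polyrcf.

Set Implicit Arguments.
Unset Strict Implicit.
Unset Printing Implicit Defensive.

Import Order.TTheory GRing.Theory Num.Theory.

Local Open Scope ring_scope.

(* [k] is 'I_k with 0-based elements: x in {1, ..., k} is the ordinal x - 1,  *)
(* and i in {1, ..., k/2} is the ordinal i - 1 of 'I_k./2. Hence the symbols  *)
(* 2i - 1 and 2i are, 0-based, i.*2 and i.*2.+1.                              *)

Lemma pair_snd_proof k (i : 'I_k./2) : (i.*2.+1 < k)%N.
Proof.
have := ltn_ord i; rewrite -leq_double doubleS => lt_ik.
apply: leq_trans lt_ik _.
by rewrite -[leqRHS]odd_double_half leq_addl.
Qed.

Definition pair_snd k (i : 'I_k./2) : 'I_k := Ordinal (pair_snd_proof i).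

Definition pair_fst k (i : 'I_k./2) : 'I_k :=
  Ordinal (ltnW (pair_snd_proof i)).

Definition is_distr (R : realType) (X : finType) (p : X -> R) : Prop :=
  (forall x, 0 <= p x) /\ \sum_x p x = 1.

(* W x y is W(y | x). *)
Definition is_channel (R : realType) (k : nat) (Y : finType)
    (W : 'I_k -> Y -> R) : Prop :=
  forall x, is_distr (W x).

Definition output (R : realType) (k : nat) (Y : finType)
    (p : 'I_k -> R) (W : 'I_k -> Y -> R) (y : Y) : R :=
  \sum_x p x * W x y.

Definition unif (R : realType) (k : nat) (x : 'I_k) : R := k%:R^-1.

(* Division by 0 yields 0, so the terms with q y = 0 contribute 0. For        *)
(* q = output (unif R k) W, q y = 0 forces W x y = 0 for all x, hence         *)
(* output p W y = 0 for every p: no infinite term is lost.                    *)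
Definition chi2 (R : realType) (Y : finType) (p q : Y -> R) : R :=
  \sum_y (p y - q y) ^+ 2 / q y.

(* Sign vectors {-1, +1}^{k/2} as bit vectors. *)
Definition signs (k : nat) := (k./2).-tuple bool.

Definition sgnb (R : realType) (b : bool) : R := if b then 1 else -1.

Definition chi2_fluct (R : realType) (k : nat) (Y : finType)
    (W : 'I_k -> Y -> R) (P : signs k -> 'I_k -> R) : R :=
  (\sum_(z : signs k) chi2 (output (P z) W) (output (unif R (k := k)) W))
    / #|{: signs k}|%:R.

(* For k even, x./2 < k./2 for all x : 'I_k, so the default value of nth is   *)
(* never used; see perturbed_fst and perturbed_snd.                           *)
Definition perturbed (R : realType) (k : nat) (eps : R) (z : signs k)
    (x : 'I_k) : R :=
  let zi := sgnb R (nth false z x./2) in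
  if odd x then (1 - 2 * eps * zi) / k%:R else (1 + 2 * eps * zi) / k%:R.

Lemma perturbed_fst (R : realType) (k : nat) (eps : R) (z : signs k)
    (i : 'I_k./2) :
  perturbed eps z (pair_fst i) = (1 + 2 * eps * sgnb R (tnth z i)) / k%:R.
Proof. by rewrite /perturbed /= odd_double doubleK (tnth_nth false). Qed.

Lemma perturbed_snd (R : realType) (k : nat) (eps : R) (z : signs k)
    (i : 'I_k./2) :
  perturbed eps z (pair_snd i) = (1 - 2 * eps * sgnb R (tnth z i)) / k%:R.
Proof.
by rewrite /perturbed /= odd_double uphalf_double (tnth_nth false).
Qed.

Definition Hmx (R : realType) (k : nat) (Y : finType) (W : 'I_k -> Y -> R) :
    'M[R]_(k./2) :=
  \matrix_(i1 < k./2, i2 < k./2)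
    \sum_(y | \sum_x W x y != 0)
      ((W (pair_fst i1) y - W (pair_snd i1) y)
       * (W (pair_fst i2) y - W (pair_snd i2) y)) / (\sum_x W x y).

(* The square roots of the eigenvalues of A^T A, with multiplicity. This      *)
(* Gram matrix is symmetric positive semidefinite, so its characteristic      *)
(* polynomial has n nonnegative real roots, counted by mup. When m < n, the   *)
(* list is the m singular values padded with n - m zeros.                     *)
Definition singular_values (R : realType) (m n : nat) (A : 'M[R]_(m, n)) :
    seq R :=
  let chi := char_poly (A^T *m A) in
  flatten [seq nseq (mup a chi) (Num.sqrt a) | a <- rootsR chi].

Definition nuclear_norm (R : realType) (m n : nat) (A : 'M[R]_(m, n)) : R :=
  \sum_(s <- singular_values A) s.

(* Main.v *)
(* Write S y = sum_x W(y|x) and d_i y = W(y|2i-1) - W(y|2i). The output under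
   p_z differs from the output under u by (2 eps / k) sum_i z_i d_i y, so
   chi^2 is (4 eps^2 / k) sum_y (sum_i z_i d_i y)^2 / S y. Averaging over the
   signs kills the cross terms and leaves (4 eps^2 / k) tr H(W).

   It remains that the nuclear norm of a symmetric positive semidefinite H is
   its trace. No diagonalization is needed: every complex root of the
   characteristic polynomial p of H is real and nonnegative, so p splits as
   prod (X - r_i), and det(X^2 - H^2) = det(X - H) det(X + H) gives that the
   characteristic polynomial of H^T H = H^2 is prod (X - r_i^2). Hence the
   singular values are the r_i, whose sum is read off p as tr H. *)

Require Import Defs.
From mathcomp Require Import all_boot all_order all_algebra.
From mathcomp Require Import reals.
From mathcomp Require Import polyrcf complex ring lra.

Import Order.TTheory GRing.Theory Num.Theory.

Local Open Scope ring_scope.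

(** * Characteristic polynomials and singular values *)

Lemma char_poly_opp (R : comNzRingType) (n : nat) (A : 'M[R]_n) :
  char_poly (- A) = (-1) ^+ n * (char_poly A \Po - 'X).
Proof.
rewrite /char_poly -[RHS]/(_ * comp_poly _ _) -det_map_mx -detZ.
congr (\det _); apply/matrixP => i j.
rewrite !mxE rmorphB rmorphMn /= comp_polyX comp_polyC polyCN mulN1r opprB.
by rewrite mulNrn !opprK addrC.
Qed.

Lemma char_poly_sqr (R : comNzRingType) (n : nat) (A : 'M[R]_n) :
  char_poly (A *m A) \Po 'X^2 = char_poly A * char_poly (- A).
Proof.
rewrite /char_poly -[LHS]/(comp_poly _ _) -det_map_mx -det_mulmx.
congr (\det _); rewrite /char_poly_mx map_mxN opprK.
rewrite mulmxBl !mulmxDr -scalar_mxM -expr2 mul_scalar_mx mul_mx_scalar.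
rewrite opprD addrA addrK map_mxB map_scalar_mx /= comp_polyX.
congr (_ - _); rewrite -map_mxM; apply/matrixP => i j.
by rewrite !mxE comp_polyC.
Qed.

Lemma char_poly_sqr_split {R : idomainType} {n : nat} {A : 'M[R]_n}
    {rs : seq R} :
  char_poly A = \prod_(r <- rs) ('X - r%:P) ->
  char_poly (A *m A) = \prod_(r <- rs) ('X - (r ^+ 2)%:P).
Proof.
move=> defA.
have szrs : size rs = n.
  by apply: succn_inj; rewrite -(size_char_poly A) defA size_prod_XsubC.
(* The sign [(-1) ^+ n] is spread over the [n] factors, turning each [- 'X - r] into ['X + r]. *)
have prodN1 (f : R -> {poly R}) :
    (-1) ^+ n * \prod_(r <- rs) f r = \prod_(r <- rs) - f r.
  rewrite -szrs; elim: rs {defA szrs} => [|r rs IH] /=.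
    by rewrite !big_nil mulr1.
  by rewrite !big_cons -IH exprS; ring.
(* Composition with ['X^2] is injective, so the identity may be checked after that substitution,
   where each factor splits as a difference of squares. *)
apply/eqP; rewrite -subr_eq0 -(@comp_poly_eq0 _ _ 'X^2) ?size_polyXn //.
rewrite rmorphB /= char_poly_sqr char_poly_opp defA !rmorph_prod /= prodN1.
rewrite -big_split /= subr_eq0; apply/eqP; apply: eq_bigr => r _.
rewrite !rmorphB /= !comp_polyX !comp_polyC rmorphXn /=.
by ring.
Qed.

Lemma nuclear_norm_split (R : realType) (n : nat) (A : 'M[R]_n) (rs : seq R) :
  A^T = A -> char_poly A = \prod_(r <- rs) ('X - r%:P) ->
  all (fun r => 0 <= r) rs -> nuclear_norm A = \tr A.
Proof.
move=> symA defA rs_ge0.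
have szrs : size rs = n.
  by apply: succn_inj; rewrite -(size_char_poly A) defA size_prod_XsubC.
have trA : \tr A = \sum_(r <- rs) r.
  (* The trace is minus the coefficient of degree [n - 1], which needs [n] positive. *)
  case: n => [|n] in A symA defA szrs *.
    by rewrite (size0nil szrs) big_nil /mxtrace big_ord0.
  apply: oppr_inj; rewrite -char_poly_trace // defA.
  by rewrite -(coefPn_prod_XsubC (ps := rs)) szrs.
rewrite trA /nuclear_norm /singular_values symA (char_poly_sqr_split defA).
rewrite big_flatten big_map /=.
rewrite -(big_map (fun r => r ^+ 2) xpredT (fun r => 'X - r%:P)).
set s := map _ _; set q := \prod_(_ <- _) _.
have qn0 : q != 0 by rewrite monic_neq0 // monic_prod_XsubC.
have -> : \sum_(r <- rs) r = \sum_(a <- s) Num.sqrt a.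
  rewrite big_map; apply: eq_big_seq => r /(allP rs_ge0) r_ge0.
  by rewrite sqrtr_sqr ger0_norm.
(* Grouping equal entries of [s] gives a sum over the distinct roots of [q] weighted by
   multiplicity, the shape of [singular_values]. *)
rewrite -(big_undup_iterop_count _ s) /=.
have roots_s : perm_eq (rootsR q) (undup s).
  apply: uniq_perm; rewrite ?uniq_roots ?undup_uniq // => x.
  by rewrite mem_undup -roots_on_rootsR // root_prod_XsubC.
rewrite (perm_big _ roots_s) /=; apply: eq_bigr => a _.
by rewrite mu_prod_XsubC big_nseq Monoid.iteropE.
Qed.

(** * Spectra of real positive semidefinite matrices *)

Lemma dot_eq0 {R : realDomainType} {n : nat} (v : 'rV[R]_n) :
  ((v *m v^T) 0 0 == 0) = (v == 0).
Proof.
have -> : (v *m v^T) 0 0 = \sum_j v 0 j ^+ 2.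
  by rewrite mxE; apply: eq_bigr => j _; rewrite mxE.
rewrite psumr_eq0 => [|j _]; last exact: sqr_ge0.
apply/allP/eqP => [v0|-> j _]; last by rewrite /= mxE expr0n eqxx.
apply/rowP => j; apply/eqP; rewrite mxE -sqrf_eq0.
by apply: v0; rewrite mem_index_enum.
Qed.

Lemma dot_ge0 {R : realDomainType} {n : nat} (v : 'rV[R]_n) :
  0 <= (v *m v^T) 0 0.
Proof.
by rewrite mxE sumr_ge0 // => j _; rewrite mxE -expr2 sqr_ge0.
Qed.

(** Splitting a complex eigenvector as [x + i y] lets the real quadratic form of [A] be evaluated on
    [x] and [y]. *)
Lemma complex_eigenvector {R : rcfType} {n : nat} {A : 'M[R]_n} {a b : R} :
  eigenvalue (map_mx (real_complex R) A) (a +i* b)%C ->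
  exists x y : 'rV[R]_n, [/\ x *m A = a *: x - b *: y,
    y *m A = a *: y + b *: x & (x != 0) || (y != 0)].
Proof.
case/eigenvalueP => v vA vn0.
have sumC (f g : 'I_n -> R) :
    \sum_j (f j +i* g j)%C = ((\sum_j f j) +i* (\sum_j g j))%C.
  by elim/big_rec3: _ => // j c d e _ ->.
exists (map_mx (@complex.Re R) v), (map_mx (@complex.Im R) v).
have eqs j :
    \sum_i complex.Re (v 0 i) * A i j
      = a * complex.Re (v 0 j) - b * complex.Im (v 0 j) /\
    \sum_i complex.Im (v 0 i) * A i j
      = a * complex.Im (v 0 j) + b * complex.Re (v 0 j).
  have /matrixP/(_ 0 j) := vA; rewrite !mxE.
  rewrite (eq_bigr (fun i => (complex.Re (v 0 i) * A i j)
                          +i* (complex.Im (v 0 i) * A i j))%C); last first.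
    move=> i _; rewrite !mxE; case: (v 0 i) => c d /=.
    by congr (_ +i* _)%C; ring.
  by rewrite sumC; case: (v 0 j) => c d /= [-> ->].
split.
- apply/rowP => j; rewrite !mxE -(eqs j).1.
  by apply: eq_bigr => i _; rewrite !mxE.
- apply/rowP => j; rewrite !mxE -(eqs j).2.
  by apply: eq_bigr => i _; rewrite !mxE.
- apply: contraNT vn0; rewrite negb_or !negbK.
  case/andP => /eqP/rowP x0 /eqP/rowP y0.
  apply/eqP/rowP => j; have := x0 j; have := y0 j; rewrite !mxE.
  by case: (v 0 j) => c d /= -> ->.
Qed.

Lemma psd_complex_eigenvalue {R : rcfType} {n : nat} {A : 'M[R]_n}
    {c : R[i]%C} :
  A^T = A -> (forall v : 'rV[R]_n, 0 <= (v *m A *m v^T) 0 0) ->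
  eigenvalue (map_mx (real_complex R) A) c ->
  c = (complex.Re c)%:C%C /\ 0 <= complex.Re c.
Proof.
move=> symA psdA; case: c => a b /complex_eigenvector [x [y [xA yA nz]]] /=.
have dotC (u v : 'rV[R]_n) : (u *m v^T) 0 0 = (v *m u^T) 0 0.
  by rewrite -[u in LHS]trmxK -trmx_mul mxE.
have pos : 0 < (x *m x^T) 0 0 + (y *m y^T) 0 0.
  rewrite lt_def addr_ge0 ?dot_ge0 // andbT paddr_eq0 ?dot_ge0 //.
  by rewrite !dot_eq0 negb_and.
(* With c = a + b i, x and y the parts of the eigenvector: symmetry of A
   equates these two numbers, whence b (|x|^2 + |y|^2) = 0. *)
have cross : (x *m A *m y^T) 0 0 = (y *m A *m x^T) 0 0.
  by rewrite dotC trmx_mul symA mulmxA.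
have := psdA x; have := psdA y; move: cross.
rewrite xA yA !mulmxDl !mulNmx -!scalemxAl.
rewrite ![(_ + _ : 'M_1) 0 0]mxE ![(- _ : 'M_1) 0 0]mxE.
rewrite ![(_ *: _ : 'M_1) 0 0]mxE (dotC y x) => cross py px.
have b0 : b = 0 by apply: (mulIf (lt0r_neq0 pos)); lra.
split; first by rewrite b0.
(* With [b = 0], the values of the form at [x] and [y] add up to [a (|x|^2 + |y|^2)]. *)
by rewrite -(pmulr_lge0 _ pos); move: px py; rewrite b0; lra.
Qed.

Lemma psd_char_poly_split {R : rcfType} {n : nat} {A : 'M[R]_n} :
  A^T = A -> (forall v : 'rV[R]_n, 0 <= (v *m A *m v^T) 0 0) ->
  exists2 rs : seq R, char_poly A = \prod_(r <- rs) ('X - r%:P)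
    & all (fun r => 0 <= r) rs.
Proof.
move=> symA psdA; pose AC := map_mx (real_complex R) A.
have [cs] := closed_field_poly_normal (char_poly AC : {poly R[i]%C}).
rewrite (monicP (char_poly_monic _)) scale1r => defAC.
have cs_ok c : c \in cs -> c = (complex.Re c)%:C%C /\ 0 <= complex.Re c.
  rewrite -root_prod_XsubC -defAC -eigenvalue_root_char.
  exact: psd_complex_eigenvalue.
exists (map (@complex.Re R) cs); last first.
  by apply/allP => _ /mapP[c /cs_ok[_ ?] ->].
(* The complex factorization descends to the reals: the embedding is injective on polynomials and
   each root equals its real part. *)
apply: (map_poly_inj (real_complex R)).
rewrite map_char_poly -/AC defAC rmorph_prod big_map.
apply: eq_big_seq => c /cs_ok[cE _].
by rewrite rmorphB /= map_polyX map_polyC /= -cE.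
Qed.

Lemma nuclear_norm_psd {R : realType} {n : nat} {A : 'M[R]_n} :
  A^T = A -> (forall v : 'rV[R]_n, 0 <= (v *m A *m v^T) 0 0) ->
  nuclear_norm A = \tr A.
Proof.
move=> symA /(psd_char_poly_split symA)[rs defA rs_ge0].
exact: nuclear_norm_split defA rs_ge0.
Qed.

(** * Sums over pairs of symbols and over signs *)

Lemma sum_pairs {V : nmodType} {k : nat} (F : 'I_k -> V) : ~~ odd k ->
  \sum_x F x = \sum_(i < k./2) (F (pair_fst i) + F (pair_snd i)).
Proof.
(* [G] extends [F] to all naturals, so that both sums run over integer ranges and yield to induction
   on [k./2]. *)
move=> evk; pose G m := oapp F 0 (insub m).
have GF (x : 'I_k) : F x = G x by rewrite /G valK.
rewrite (eq_bigr _ (fun x _ => GF x)).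
rewrite [RHS](eq_bigr (fun i : 'I_k./2 => G i.*2 + G i.*2.+1)); last first.
  by move=> i _; rewrite !GF.
rewrite -(big_mkord xpredT G) -(big_mkord xpredT (fun i => G i.*2 + G i.*2.+1)).
have {1}-> : k = k./2.*2 by rewrite -[LHS]odd_double_half (negbTE evk).
elim: k./2 => [|m IH]; first by rewrite !big_geq.
by rewrite doubleS !big_nat_recr //= IH addrA.
Qed.

Lemma sgnb_sqr (R : realType) (b : bool) : sgnb R b ^+ 2 = 1.
Proof. by case: b; rewrite /= ?expr1n // sqrrN expr1n. Qed.

Definition flip_bit {n : nat} (i : 'I_n) (z : n.-tuple bool) : n.-tuple bool :=
  [tuple (j == i) (+) tnth z j | j < n].

Lemma flip_bitK {n : nat} (i : 'I_n) : involutive (flip_bit i).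
Proof. by move=> z; apply: eq_from_tnth => j; rewrite !tnth_mktuple addKb. Qed.

(* Flipping bit i is an involution that negates the sum when i != j. *)
Lemma sum_sgnb_mul (R : realType) (n : nat) (i j : 'I_n) :
  \sum_(z : n.-tuple bool) sgnb R (tnth z i) * sgnb R (tnth z j) =
  #|{: n.-tuple bool}|%:R *+ (i == j).
Proof.
have [->|neq_ij] := eqVneq i j.
  rewrite (eq_bigr (fun=> 1)) => [|z _]; last by rewrite -expr2 sgnb_sqr.
  by rewrite sumr_const.
set S := LHS.
have : S = - S.
  rewrite {1}/S (reindex_inj (inv_inj (flip_bitK i))) -sumrN.
  apply: eq_bigr => z _.
  rewrite !tnth_mktuple eqxx eq_sym (negbTE neq_ij) /= -mulNr.
  by case: (tnth z i); rewrite ?opprK.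
by move/eqP; rewrite -subr_eq0 opprK -mulr2n mulrn_eq0 => /eqP.
Qed.

(** Second moment of a Rademacher sum: by [sum_sgnb_mul], only the diagonal of the expanded square
    survives. *)
Lemma sum_sqr_signed (R : realType) (n : nat) (d : 'I_n -> R) :
  \sum_(z : n.-tuple bool) (\sum_i sgnb R (tnth z i) * d i) ^+ 2 =
  #|{: n.-tuple bool}|%:R * \sum_i d i ^+ 2.
Proof.
under eq_bigr => z _.
  rewrite expr2 mulr_suml; under eq_bigr => i _ do rewrite mulr_sumr.
  over.
rewrite exchange_big mulr_sumr; apply: eq_bigr => i _.
rewrite exchange_big (bigD1 i) //= [X in _ + X]big1 => [|j neq_ji].
  rewrite addr0; under eq_bigr => z _ do rewrite mulrACA.
  by rewrite -mulr_suml sum_sgnb_mul eqxx expr2.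
under eq_bigr => z _ do rewrite mulrACA.
by rewrite -mulr_suml sum_sgnb_mul eq_sym (negbTE neq_ji) mul0r.
Qed.

(** * The matrix [H(W)] and the chi-square fluctuation *)

Definition pair_diff {R : realType} {k : nat} {Y : finType}
    (W : 'I_k -> Y -> R) (i : 'I_k./2) (y : Y) : R :=
  W (pair_fst i) y - W (pair_snd i) y.

Lemma output_unif (R : realType) (k : nat) (Y : finType)
    (W : 'I_k -> Y -> R) (y : Y) :
  output (unif R (k := k)) W y = (\sum_x W x y) / k%:R.
Proof. by rewrite /output -mulr_sumr mulrC. Qed.

Lemma output_perturbed_sub_unif (R : realType) (k : nat) (Y : finType)
    (W : 'I_k -> Y -> R) (eps : R) (z : signs k) (y : Y) : ~~ odd k ->
  output (perturbed eps z) W y - output (unif R (k := k)) W y =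
  2 * eps / k%:R * \sum_i sgnb R (tnth z i) * pair_diff W i y.
Proof.
move=> evk; rewrite /output -sumrB (sum_pairs _ evk) mulr_sumr.
apply: eq_bigr => i _.
by rewrite perturbed_fst perturbed_snd /unif /pair_diff; ring.
Qed.

Lemma trace_Hmx (R : realType) (k : nat) (Y : finType) (W : 'I_k -> Y -> R) :
  \tr (Hmx W) = \sum_y (\sum_i pair_diff W i y ^+ 2) / \sum_x W x y.
Proof.
rewrite /mxtrace; under eq_bigr => i _.
  rewrite mxE big_mkcond /=.
  rewrite (eq_bigr (fun y => pair_diff W i y ^+ 2 / \sum_x W x y)); first over.
  (* For [y] of zero mass, the term that [Hmx] omits is also 0 in the full sum, since the inverse of
     0 is 0. *)
  by move=> y _; case: eqP => [->|_]; rewrite ?invr0 ?mulr0 // expr2.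
by rewrite exchange_big; apply: eq_bigr => y _; rewrite -mulr_suml.
Qed.

Lemma tr_Hmx (R : realType) (k : nat) (Y : finType) (W : 'I_k -> Y -> R) :
  (Hmx W)^T = Hmx W.
Proof.
apply/matrixP => i j; rewrite !mxE; apply: eq_bigr => y _.
by rewrite [X in X / _]mulrC.
Qed.

(** [Hmx W] is a Gram matrix, so its form is a sum over [y] of squares weighted by inverse
    masses. *)
Lemma Hmx_psd (R : realType) (k : nat) (Y : finType) (W : 'I_k -> Y -> R)
    (v : 'rV[R]_k./2) :
  (forall x y, 0 <= W x y) -> 0 <= (v *m Hmx W *m v^T) 0 0.
Proof.
move=> W_ge0.
have -> : (v *m Hmx W *m v^T) 0 0 =
    \sum_(y | \sum_x W x y != 0)
      (\sum_i v 0 i * pair_diff W i y) ^+ 2 / \sum_x W x y.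
  rewrite mxE; under eq_bigr => j _.
    rewrite !mxE mulr_suml.
    under eq_bigr => i _ do rewrite mxE mulr_sumr mulr_suml.
    rewrite exchange_big; over.
  rewrite exchange_big; apply: eq_bigr => y _.
  rewrite expr2 mulr_sumr mulr_suml; apply: eq_bigr => j _.
  rewrite -mulrA mulr_suml; apply: eq_bigr => i _.
  by rewrite /pair_diff; ring.
by apply: sumr_ge0 => y _; rewrite divr_ge0 ?sqr_ge0 ?sumr_ge0.
Qed.

Theorem theorem4p9 (R : realType) (k : nat) (hk2 : (2 <= k)%N)
    (hk : ~~ odd k) (eps : R) (heps0 : 0 < eps) (heps : eps <= 1 / 2)
    (Y : finType) (W : 'I_k -> Y -> R) (hW : is_channel W) :
  chi2_fluct W (perturbed eps) = 4 * eps ^+ 2 / k%:R * nuclear_norm (Hmx W).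
Proof.
have kn0 : k%:R != 0 :> R by rewrite pnatr_eq0 -lt0n ltnW.
have Nn0 : #|{: (k./2).-tuple bool}|%:R != 0 :> R.
  by rewrite pnatr_eq0 card_tuple card_bool expn_eq0.
rewrite (nuclear_norm_psd (tr_Hmx _ _ _ W)); last first.
  by move=> v; apply: Hmx_psd => x y; have [] := hW x.
rewrite trace_Hmx /chi2_fluct /signs /chi2 exchange_big mulr_suml mulr_sumr.
apply: eq_bigr => y _; rewrite output_unif.
(* The square is moved last so that the factor free of [z], [(2 eps / k)^2] times [k] over the mass
   of [y], leaves the sum over signs. *)
under eq_bigr => z _ do
  rewrite -output_unif output_perturbed_sub_unif // output_unif exprMn mulrAC.
rewrite -mulr_sumr sum_sqr_signed invf_div.
(* The channel may never output y: its inverse mass is kept as an atom. *)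
move: (\sum_x W x y)^-1 => w.
by field; rewrite kn0.
Qed.
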